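(* There is an absolute constant $C>0$ such that for every set $S$ of $n\ge 3$ points in the plane, the number of acute triangles with vertices in $S$ whose area equals the minimum nonzero area among all triangles with vertices in $S$ is at most $C n$. Moreover, this is asymptotically tight: there is an absolute constant $c>0$ such that for every $n\ge 3$ there is a set of $n$ points in the plane with at least $c n$ acute triangles of minimum nonzero area.
   Context: A triangle spanned by $S$ is an unordered triple of points of $S$; collinear triples are allowed in $S$ but have area $0$ and are not counted. An acute triangle is one all of whose angles are strictly less than $\pi/2$. *)

(* Defs.v *)
From mathcomp Require Export all_boot all_order all_algebra finmap.
From mathcomp Require Export all_classical all_reals all_analysis.

Set Implicit Arguments.
Unset Strict Implicit.
Unset Printing Implicit Defensive.

Import Order.TTheory GRing.Theory Num.Theory.
Local Open Scope ring_scope.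
Local Open Scope fset_scope.

Section PlaneTriangles.
Variable R : realType.

Definition point : Type := (R * R)%type.

(* The Euclidean structure is written out because the library norm on a
   product type is the sup norm. *)
Definition dot (u v : point) : R := u.1 * v.1 + u.2 * v.2.
Definition enorm (u : point) : R := Num.sqrt (dot u u).

(* The angle at the middle argument q. *)
Definition angle (p q r : point) : R :=
  acos (dot (p - q) (r - q) / (enorm (p - q) * enorm (r - q))).

Definition area (p q r : point) : R :=
  `|(q.1 - p.1) * (r.2 - p.2) - (q.2 - p.2) * (r.1 - p.1)| / 2.

Definition acute (p q r : point) : Prop :=
  [/\ angle r p q < pi / 2, angle p q r < pi / 2 & angle q r p < pi / 2].

Definition spanned (S : {fset point}) (p q r : point) : bool :=
  [&& p \in S, q \in S, r \in S & uniq [:: p; q; r]].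

Definition has_min_area (S : {fset point}) (p q r : point) : Prop :=
  area p q r != 0 /\
  forall p' q' r' : point, spanned S p' q' r' -> area p' q' r' != 0 ->
    area p q r <= area p' q' r'.

(* Triangles are unordered, hence counted as subsets of S; [acute] and [area]
   do not depend on the order of the vertices. *)
Definition min_acute_triangles (S : {fset point}) : {fset {fset point}} :=
  [fset T in fpowerset S | `[< exists p q r : point,
     [/\ T = [fset p; q; r], spanned S p q r, acute p q r
       & has_min_area S p q r] >] ].

End PlaneTriangles.

(* Main.v *)
(** Upper bound: let [qp] be the shortest side of an acute triangle [qpr] of
    minimum area, oriented so that [r] lies on its left.  Two such sides [qp] and
    [qp'] at an angle of less than 60 degrees span a triangle of area below the
    minimum, so they are collinear, and then [p = p'], since otherwise replacing
    the farther of the two by the nearer shrinks a minimum triangle.  Acuteness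
    makes [r] project inside [qp]; two apexes [r], [r'] over the same side would
    thus be less than [|qp|] apart, and [qrr'] would be too small.  Hence a
    triangle is determined by [q] and the octant of [p - q], which gives at most
    [8 n] of them.

    Lower bound: consecutive triples of the zigzag [(k, 0)], [k] even, and
    [(k, 2)], [k] odd, are acute and have the area of half a lattice cell. *)

From mathcomp Require Import zify ring lra.
Require Import Defs.
Import Order.TTheory GRing.Theory Num.Theory.
Local Open Scope ring_scope.
Local Open Scope fset_scope.

Section Plane.
Set Implicit Arguments.
Unset Strict Implicit.
Local Open Scope ring_scope.
Variable R : realType.
Implicit Types (u v w p q r : point R) (S T : {fset point R}).

(** * Areas and angles through cross and dot products *)

Definition cross u v : R := u.1 * v.2 - u.2 * v.1.

Lemma area_cross p q r : area p q r = `|cross (q - p) (r - p)| / 2.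
Proof. by []. Qed.

Lemma area_rot p q r : area q r p = area p q r.
Proof. by rewrite /area; congr (`|_| / 2); ring. Qed.

Lemma area_swap p q r : area q p r = area p q r.
Proof. by rewrite /area -normrN; congr (`|_| / 2); ring. Qed.

Lemma area_uniq p q r : area p q r != 0 -> uniq [:: p; q; r].
Proof.
apply: contra_neqT; rewrite /= !inE andbT negb_and !negbK /area.
move=> H; suff -> : (q.1 - p.1) * (r.2 - p.2) - (q.2 - p.2) * (r.1 - p.1) = 0.
  by rewrite normr0 mul0r.
by case/orP: H => [/orP[]|] /eqP->; ring.
Qed.

Lemma dot_gt0 u : u != 0 -> 0 < dot u u.
Proof.
case: u => x y; rewrite /dot /= -pair_eqE /= negb_and => H.
have : 0 <= x ^+ 2 by exact: sqr_ge0.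
have : 0 <= y ^+ 2 by exact: sqr_ge0.
case/orP: H => H; have := H; rewrite -sqrf_eq0 => H2.
  have : 0 < x ^+ 2 by rewrite lt_def H2 sqr_ge0.
  by nra.
have : 0 < y ^+ 2 by rewrite lt_def H2 sqr_ge0.
by nra.
Qed.

Lemma lagrange_identity u v :
  cross u v ^+ 2 + dot u v ^+ 2 = dot u u * dot v v.
Proof. by rewrite /cross /dot; ring. Qed.

Lemma angle_lt_pihalf p q r : p != q -> r != q ->
  (angle p q r < pi / 2) <-> (0 < dot (p - q) (r - q)).
Proof.
rewrite -![_ == q]subr_eq0 /angle => /dot_gt0 u0 /dot_gt0 v0.
move: (p - q) (r - q) u0 v0 => u v u0 v0.
set N := enorm u * enorm v; set t := dot u v / N.
have N0 : 0 < N by rewrite mulr_gt0 // sqrtr_gt0.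
have N2 : N ^+ 2 = dot u u * dot v v by rewrite exprMn !sqr_sqrtr // ltW.
have tN : dot u v = t * N by rewrite /t mulfVK // gt_eqF.
(* Cauchy-Schwarz, read off from the Lagrange identity, puts [t] in the domain of [acos]. *)
have t1 : -1 <= t <= 1.
  rewrite -ler_norml -(ler_pM2r N0) mul1r -[in leLHS](ger0_norm (ltW N0)).
  rewrite -normrM -tN -(ger0_norm (ltW N0)) -ler_sqr ?nnegrE //.
  rewrite !real_normK ?num_real // N2 -lagrange_identity lerDr.
  exact: sqr_ge0.
have [/andP[a0 api] ca] := acos_def t1.
rewrite tN pmulr_lgt0 //; split => H.
  rewrite -ca; apply: cos_gt0_pihalf; rewrite H andbT.
  by apply: lt_le_trans a0; rewrite oppr_lt0 divr_gt0 // pi_gt0.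
rewrite ltNge; apply/negP => H2.
have : 0 <= cos (pi - acos t).
  by apply: cos_ge0_pihalf; have := @pi_gt0 R; move: H2 api; lra.
by rewrite cosB cospi sinpi ca; move: H; lra.
Qed.

Definition acute_dots p q r :=
  [/\ 0 < dot (r - p) (q - p), 0 < dot (p - q) (r - q)
    & 0 < dot (q - r) (p - r)].

Lemma acuteP p q r : uniq [:: p; q; r] -> acute p q r <-> acute_dots p q r.
Proof.
rewrite /= !inE andbT negb_or => /andP[/andP[pq pr] qr].
have [qp rp rq] : [/\ q != p, r != p & r != q] by split; rewrite eq_sym.
have := @angle_lt_pihalf r p q rp qp; have := @angle_lt_pihalf p q r pq rq.
have := @angle_lt_pihalf q r p qr pr; rewrite /acute /acute_dots.
by move=> [? ?] [? ?] [? ?]; split=> -[? ? ?]; split; auto.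
Qed.

(** * Minimum acute triangles and their shortest sides *)

Definition min_acute S T p q r :=
  [/\ T = [fset p; q; r], spanned S p q r, acute_dots p q r
    & has_min_area S p q r].

Lemma min_acute_rot S T p q r : min_acute S T p q r -> min_acute S T q r p.
Proof.
move=> [-> /and4P[pS qS rS _] [d1 d2 d3] m].
have m' : has_min_area S q r p by rewrite /has_min_area area_rot.
split=> //.
- by apply/fsetP => x; rewrite !inE; do 3 case: (x == _).
- by rewrite /spanned qS rS pS area_uniq // (proj1 m').
Qed.

Lemma min_acute_swap S T p q r : min_acute S T p q r -> min_acute S T q p r.
Proof.
move=> [-> /and4P[pS qS rS _] [d1 d2 d3] m].
have m' : has_min_area S q p r by rewrite /has_min_area area_swap.
split=> //.
- by apply/fsetP => x; rewrite !inE; do 3 case: (x == _).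
- by rewrite /spanned qS rS pS area_uniq // (proj1 m').
- have dotC (a b : point R) : dot a b = dot b a by rewrite /dot; ring.
  by split; rewrite dotC.
Qed.

(* With [s] the squared length of [qp] and [m] twice the area, the bound
   [3 s ^ 2 <= 4 m ^ 2] expresses that [qp] is a shortest side: the angle between
   the two shorter sides is the largest one, hence at least 60 degrees. *)
Definition short_side S T q p r :=
  [/\ min_acute S T q p r, 0 < cross (p - q) (r - q)
    & 3 * dot (p - q) (p - q) ^+ 2 <= 4 * cross (p - q) (r - q) ^+ 2].

Lemma shortest_side_bound u v :
  dot u u <= dot v v -> dot u u <= dot (u - v) (u - v) ->
  0 < dot u v -> 0 < dot u (u - v) ->
  3 * dot u u ^+ 2 <= 4 * cross u v ^+ 2.
Proof.
have -> : dot (u - v) (u - v) = dot u u + dot v v - 2 * dot u v.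
  by rewrite /dot /=; ring.
have -> : dot u (u - v) = dot u u - dot u v by rewrite /dot /=; ring.
have -> : cross u v ^+ 2 = dot u u * dot v v - dot u v ^+ 2.
  by rewrite -lagrange_identity; ring.
move: (dot u u) (dot v v) (dot u v) => s b d sb sd d0 ds.
(* The goal is [3 * s ^ 2 <= 4 * (s * b - d ^ 2)]. For [2 * d <= s] the bound [s <= b] suffices;
   otherwise the third side gives [2 * d <= b], and [d < s] settles the rest. *)
have [h|h] := lerP (2 * d) s.
  have : 0 <= s * (b - s) by apply: mulr_ge0; lra.
  have : 0 <= (s - 2 * d) * (s + 2 * d) by apply: mulr_ge0; lra.
  by nra.
have : 0 <= s * (b - 2 * d) by apply: mulr_ge0; lra.
have : 0 <= (2 * d - s) * (3 * s - 2 * d) by apply: mulr_ge0; lra.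
by nra.
Qed.

Lemma short_side_exists S T p q r : min_acute S T p q r ->
  exists q' p' r', short_side S T q' p' r'.
Proof.
move=> H.
have [a [b [c [{}H ab ac]]]] : exists a b c, [/\ min_acute S T a b c,
    dot (b - a) (b - a) <= dot (c - a) (c - a) &
    dot (b - a) (b - a) <= dot (b - c) (b - c)].
  have dC (x y : point R) : dot (x - y) (x - y) = dot (y - x) (y - x).
    by rewrite /dot /=; ring.
  have Hq := min_acute_rot H; have Hr := min_acute_rot Hq.
  have [h1|/ltW h1] := lerP (dot (q - p) (q - p)) (dot (r - p) (r - p));
  have [h2|/ltW h2] := lerP (dot (q - p) (q - p)) (dot (r - q) (r - q));
  have [h3|/ltW h3] := lerP (dot (r - p) (r - p)) (dot (r - q) (r - q));
  solve [ exists p, q, r; split; rewrite // ?(dC q r) //; lra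
        | exists q, r, p; split; rewrite // ?(dC p q) ?(dC p r) //; lra
        | exists r, p, q; split; rewrite // ?(dC p r) ?(dC q r) ?(dC p q) //; lra].
have bound x y z : min_acute S T x y z ->
    dot (y - x) (y - x) <= dot (z - x) (z - x) ->
    dot (y - x) (y - x) <= dot (y - z) (y - z) ->
    3 * dot (y - x) (y - x) ^+ 2 <= 4 * cross (y - x) (z - x) ^+ 2.
  move=> [_ _ [d1 d2 _] _] h1 h2; apply: shortest_side_bound => //.
  - by move: h2; rewrite /dot /=; lra.
  - by move: d1; rewrite /dot /=; lra.
  - by move: d2; rewrite /dot /=; lra.
have [h|h] := ltrP 0 (cross (b - a) (c - a)).
  by exists a, b, c; split=> //; exact: bound.
(* For a clockwise triangle the ends of the side are exchanged, which negates the cross product; it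
   is nonzero because the area is. *)
have H' := min_acute_swap H.
exists b, a, c; split=> //; last first.
  by apply: bound => //; move: ab ac; rewrite /dot /=; lra.
have [_ _ _ [m _]] := H'; move: m; rewrite area_cross => m.
have -> : cross (a - b) (c - b) = - cross (b - a) (c - a).
  by rewrite /cross /=; ring.
rewrite oppr_gt0 lt_def h andbT.
apply: contraNneq m => m.
suff -> : cross (a - b) (c - b) = 0 by rewrite normr0 mul0r.
by move: m; rewrite /cross /=; lra.
Qed.

(** * Vectors in a common octant *)

Definition octant u : bool * bool * bool :=
  (0 <= u.1, 0 <= u.2, `|u.2| <= `|u.1|).

Lemma same_sign_mul_ge0 (x y : R) : (0 <= x) = (0 <= y) -> 0 <= x * y.
Proof. by case: (lerP 0 x); case: (lerP 0 y) => // hy hx _; nra. Qed.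

(** The angle is at most 45 degrees, so its squared sine is at most one half. *)
Lemma octant_cross u v : octant u = octant v ->
  2 * cross u v ^+ 2 <= dot u u * dot v v.
Proof.
case: u v => [x y] [z t]; rewrite /octant /cross /dot /=.
case=> /same_sign_mul_ge0 xz /same_sign_mul_ge0 yt.
rewrite -ler_sqr ?nnegrE // -[X in _ = X]ler_sqr ?nnegrE //.
rewrite !real_normK ?num_real // => h.
rewrite -![_ ^+ 2 <= _]subr_ge0 in h.
have /same_sign_mul_ge0 k := h.
have xyzt : 0 <= (x * z) * (y * t) by exact: mulr_ge0.
(* The difference of the two sides is [(x ^ 2 - y ^ 2) * (z ^ 2 - t ^ 2) + 4 * (x * z) * (y *
   t)]. *)
by rewrite -subr_ge0; move: k xyzt; lra.
Qed.

(** Both coordinate products are nonnegative. If both vanished, the vectors would lie on different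
    axes, against the third component of [octant]. *)
Lemma octant_dot_gt0 u v : u != 0 -> v != 0 -> octant u = octant v ->
  0 < dot u v.
Proof.
case: u v => [x y] [z t]; rewrite /octant /dot /= -!pair_eqE /= => u0 v0.
case=> /same_sign_mul_ge0 xz /same_sign_mul_ge0 yt h.
rewrite lt_def addr_ge0 // andbT paddr_eq0 // !mulf_eq0.
apply/negP => /andP[/orP[] /eqP a /orP[] /eqP b].
- by move: u0; rewrite a b eqxx.
- by move: h u0 v0; rewrite a b normr0 normr_ge0 normr_le0 eqxx => ->.
- by move: h u0 v0; rewrite a b normr0 normr_ge0 normr_le0 eqxx => <-.
- by move: v0; rewrite a b eqxx.
Qed.

(** * Rigidity of short sides at a common vertex *)

Lemma min_cross S p q r m : 0 < m ->
  (forall p' q' r' : point R, spanned S p' q' r' -> area p' q' r' != 0 ->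
    m / 2 <= area p' q' r') ->
  p \in S -> q \in S -> r \in S ->
  cross (q - p) (r - p) != 0 -> m <= `|cross (q - p) (r - p)|.
Proof.
move=> m0 min pS qS rS c0.
have a0 : area p q r != 0 by rewrite area_cross mulf_neq0 ?normr_eq0 // invr_eq0.
have := min p q r; rewrite /spanned pS qS rS area_uniq // => /(_ isT a0).
by rewrite area_cross ler_pM2r // invr_gt0.
Qed.

Lemma short_side_min S T q p r x y z : short_side S T q p r ->
  x \in S -> y \in S -> z \in S -> cross (y - x) (z - x) != 0 ->
  cross (p - q) (r - q) <= `|cross (y - x) (z - x)|.
Proof.
move=> [[_ _ _ [_ min]] c0 _]; apply: min_cross => // p' q' r' sp a0.
by have := min _ _ _ sp a0; rewrite (area_cross q p r) gtr0_norm.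
Qed.

(** Both values are twice the minimum area of [S], so each bounds the other. *)
Lemma short_side_cross S T T' q p r q' p' r' :
  short_side S T q p r -> short_side S T' q' p' r' ->
  cross (p - q) (r - q) = cross (p' - q') (r' - q').
Proof.
move=> H H'; apply/le_anti.
have [[_ /and4P[qS pS rS _] _ _] c0 _] := H.
have [[_ /and4P[qS' pS' rS' _] _ _] c0' _] := H'.
rewrite -[X in _ <= X](gtr0_norm c0') (short_side_min H) ?gt_eqF //=.
by rewrite -[X in _ <= X](gtr0_norm c0) (short_side_min H') ?gt_eqF.
Qed.

Lemma short_side_apex S T T' q p r r' :
  short_side S T q p r -> short_side S T' q p r' -> r = r'.
Proof.
move=> H H'; have c := short_side_cross H H'.
have [[_ /and4P[qS pS rS _] [d1 d2 _] _] c0 _] := H.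
have [[_ /and4P[qS' pS' rS' _] [d1' d2' _] _] c0' _] := H'.
have min := short_side_min H qS rS rS'.
set u := p - q; set v := r - q; set w := r' - q.
have e1 : dot u v = dot (r - q) (p - q) by rewrite /dot mulrC [X in _ + X]mulrC.
have e2 : dot u w = dot (r' - q) (p - q) by rewrite /dot mulrC [X in _ + X]mulrC.
have e3 : dot (q - p) (r - p) = dot u u - dot u v by rewrite /dot /=; ring.
have e4 : dot (q - p) (r' - p) = dot u u - dot u w by rewrite /dot /=; ring.
rewrite -e1 in d1; rewrite -e2 in d1'; rewrite e3 in d2; rewrite e4 in d2'.
rewrite -/u -/v -/w in c c0 min.
have u0 : 0 < dot u u by lra.
(* Equal heights over [u] make [v - w] a multiple of [u], with factor
   [(dot u v - dot u w) / dot u u]. *)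
have key : dot u u * cross v w = (dot u v - dot u w) * cross u v.
  have -> : (dot u v - dot u w) * cross u v =
    dot u v * cross u w - dot u w * cross u v by rewrite c; ring.
  by rewrite /dot /cross; ring.
(* Acuteness at [q] and [p] puts both dot products strictly between 0 and [dot u u]. The factor is
   thus below 1 in absolute value, and a nonzero [cross v w] would undercut the minimum. *)
have [z|nz] := eqVneq (cross v w) 0; last first.
  have := min nz; rewrite -(ler_pM2l u0) -[X in X * `|_|](gtr0_norm u0).
  rewrite -normrM key normrM (gtr0_norm c0) ler_pM2r //.
  by rewrite leNgt real_ltr_norml ?num_real // => /negP[]; apply/andP; split; lra.
have dd : dot u v = dot u w.
  apply/eqP; rewrite -subr_eq0; move/eqP: key; rewrite z mulr0 eq_sym mulf_eq0.
  by rewrite (gt_eqF c0) orbF.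
have uvw : v = w.
  have k1 : dot u u * (v.1 - w.1) = 0.
    have -> : dot u u * (v.1 - w.1) =
      u.1 * (dot u v - dot u w) - u.2 * (cross u v - cross u w).
      by rewrite /dot /cross; ring.
    by rewrite dd c !subrr !mulr0 subrr.
  have k2 : dot u u * (v.2 - w.2) = 0.
    have -> : dot u u * (v.2 - w.2) =
      u.2 * (dot u v - dot u w) + u.1 * (cross u v - cross u w).
      by rewrite /dot /cross; ring.
    by rewrite dd c !subrr !mulr0 addr0.
  move/eqP: k1; rewrite mulf_eq0 gt_eqF //= subr_eq0 => /eqP k1.
  move/eqP: k2; rewrite mulf_eq0 gt_eqF //= subr_eq0 => /eqP k2.
  by apply: injective_projections.
exact: (addIr (- q)).
Qed.

(** Minimality is used twice: on [q], [p], [p'] to force collinearity, then on [q], [p], [r'] to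
    force equal lengths. *)
Lemma short_side_foot_le S T T' q p p' r r' :
  short_side S T q p r -> short_side S T' q p' r' ->
  octant (p - q) = octant (p' - q) ->
  dot (p - q) (p - q) <= dot (p' - q) (p' - q) -> p = p'.
Proof.
move=> H H' oct le; have c := short_side_cross H H'.
have [[_ /and4P[qS pS rS U] _ _] c0 b] := H.
have [[_ /and4P[_ pS' rS' U'] _ _] c0' b'] := H'.
have u0 : p - q != 0.
  by rewrite subr_eq0 eq_sym; move: U; rewrite /= !inE negb_or -andbA => /and3P[].
have u0' : p' - q != 0.
  by rewrite subr_eq0 eq_sym; move: U'; rewrite /= !inE negb_or -andbA => /and3P[].
have d0 := octant_dot_gt0 u0 u0' oct; have cr := octant_cross oct.
have s0 := dot_gt0 u0; have s0' := dot_gt0 u0'.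
have min1 := short_side_min H qS pS pS'.
have min2 := short_side_min H' qS pS rS'.
move: c; set m := cross (p - q) _ => c; rewrite -c in c0' b' min2.
rewrite -/m in c0 b min1.
suff uu : p - q = p' - q by exact: (addIr (- q)).
move: (p - q) (p' - q) (r' - q) d0 cr s0 s0' min1 min2 c le b b'
  => u u' v' d0 cr s0 s0' min1 min2 c le b b' {u0 u0' oct}.
have z : cross u u' = 0.
  have [//|/min1] := eqVneq (cross u u') 0.
  rewrite -ler_sqr ?nnegrE ?(ltW c0) ?normr_ge0 //.
  rewrite real_normK ?num_real // => h; exfalso.
  have m2 : 0 < m ^+ 2 by rewrite exprn_gt0.
  (* The two short-side bounds multiply to [9 * P ^ 2 <= 16 * m ^ 4] with [P = dot u u * dot u' u'],
     while the octant bound and minimality give [2 * m ^ 2 <= P]. Together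
     [36 * m ^ 4 <= 16 * m ^ 4]. *)
  have : (3 * dot u u ^+ 2) * (3 * dot u' u' ^+ 2) <= (4 * m ^+ 2) * (4 * m ^+ 2).
    by apply: ler_pM => //; rewrite mulr_ge0 // sqr_ge0.
  have : (2 * m ^+ 2) * (2 * m ^+ 2) <=
      (dot u u * dot u' u') * (dot u u * dot u' u').
    by apply: ler_pM; lra.
  have : 0 < m ^+ 2 * m ^+ 2 by rewrite mulr_gt0.
  by lra.
(* Now [u] is [dot u u' / dot u' u'] times [u']; minimality makes this factor at least 1, and [u]
   being no longer than [u'] makes it at most 1. *)
have key : dot u' u' * cross u v' = dot u u' * m.
  have -> : dot u' u' * cross u v' =
    dot u u' * cross u' v' + cross u u' * dot u' v'.
    by rewrite /dot /cross; ring.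
  by rewrite z mul0r addr0 c.
have cp : 0 < cross u v' by rewrite -(pmulr_rgt0 _ s0') key mulr_gt0.
have : dot u' u' * m <= dot u u' * m.
  by rewrite -key ler_pM2l // -[X in _ <= X]gtr0_norm // min2 // gt_eqF.
rewrite ler_pM2r // => h.
have lag := lagrange_identity u u'; rewrite z expr0n add0r in lag.
have dd : dot u u' = dot u' u'.
  apply/le_anti; rewrite h andbT -ler_sqr ?nnegrE ?(ltW d0) ?(ltW s0') // lag expr2.
  by rewrite ler_pM2r.
have k1 : dot u' u' * u.1 = dot u' u' * u'.1.
  rewrite -[in RHS]dd.
  have -> : dot u' u' * u.1 = dot u u' * u'.1 + cross u u' * u'.2.
    by rewrite /dot /cross; ring.
  by rewrite z mul0r addr0.
have k2 : dot u' u' * u.2 = dot u' u' * u'.2.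
  rewrite -[in RHS]dd.
  have -> : dot u' u' * u.2 = dot u u' * u'.2 - cross u u' * u'.1.
    by rewrite /dot /cross; ring.
  by rewrite z mul0r subr0.
by apply: injective_projections; apply: (mulfI (lt0r_neq0 s0')).
Qed.

Lemma short_side_inj S T T' q p p' r r' :
  short_side S T q p r -> short_side S T' q p' r' ->
  octant (p - q) = octant (p' - q) -> T = T'.
Proof.
move=> H H' oct.
have pp : p = p'.
  have [le|/ltW le] := lerP (dot (p - q) (p - q)) (dot (p' - q) (p' - q)).
    exact: (short_side_foot_le H H' oct le).
  by apply/esym; apply: (short_side_foot_le H' H (esym oct) le).
rewrite -pp in H'; have rr := short_side_apex H H'.
by have [[-> _ _ _] _ _] := H; have [[-> _ _ _] _ _] := H'; rewrite rr.
Qed.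

(** * Counting triangles by vertex and octant *)

Lemma min_acute_trianglesP S T : T \in min_acute_triangles S <->
  T `<=` S /\ exists p q r, min_acute S T p q r.
Proof.
rewrite /min_acute_triangles !inE fpowersetE; split.
  move=> /andP[-> /asboolP[p [q [r [-> sp ac m]]]]]; split=> //.
  by exists p, q, r; split=> //; apply/acuteP => //; case/and4P: sp.
move=> [-> [p [q [r [-> sp ac m]]]]]; apply/asboolP.
by exists p, q, r; split=> //; apply/acuteP => //; case/and4P: sp.
Qed.

Lemma min_acute_triangles_le S : (#|` min_acute_triangles S| <= #|` S| * 8)%N.
Proof.
have [|f fP] := @choice _ _ (fun T (y : point R * (bool * bool * bool)) =>
    T \in min_acute_triangles S ->
    exists q p r, short_side S T q p r /\ y = (q, octant (p - q))).
  move=> T.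
  case: (boolP (T \in _)) => [/min_acute_trianglesP[_ [p [q [r H]]]]|_].
    have [a [b [c H']]] := short_side_exists H.
    by exists (a, octant (b - a)) => _; exists a, b, c.
  (* An arbitrary value off the family; injectivity is claimed only on it. *)
  by exists (0, (true, true, true)).
have f_inj : {in enum_fset (min_acute_triangles S) &, injective f}.
  move=> T T' /fP[q [p [r [H ->]]]] /fP[q' [p' [r' [H' ->]]]] [eq e1 e2 e3].
  rewrite -eq in H' e1 e2 e3.
  by apply: (short_side_inj H H'); rewrite /octant e1 e2 e3.
rewrite -(size_map f).
have <- : size [seq (q, o) | q <- enum_fset S, o <- enum {: bool * bool * bool}]
    = (#|` S| * 8)%N.
  by rewrite size_allpairs -cardE !card_prod card_bool.
apply: uniq_leq_size; first by rewrite map_inj_in_uniq ?fset_uniq.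
move=> _ /mapP[T /fP[q [p [r [H ->]]]] ->].
apply/allpairsP; exists (q, octant (p - q)); split=> //=.
  by have [[_ /and4P[]]] := H.
by rewrite mem_enum.
Qed.

(** * The zigzag construction for the lower bound *)

Definition zigzag (k : nat) : point R := (k%:R, 2 * (odd k)%:R).

Lemma zigzag_inj : injective zigzag.
Proof. by move=> i j [] /eqP; rewrite eqr_nat => /eqP. Qed.

(* [zigzag] takes values in the lattice spanned by [(2, 0)] and [(1, 2)], whose
   determinant is 4. *)
Lemma zigzag_cross i j k : exists z : int,
  cross (zigzag j - zigzag i) (zigzag k - zigzag i) = 4 * z%:~R.
Proof.
(* In the lattice basis [zigzag k] has coordinates [k./2] and [odd k]; the witness is the
   determinant in these coordinates. *)
exists (((j./2)%:Z - (i./2)%:Z) * ((odd k : nat)%:Z - (odd i : nat)%:Z) -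
  ((odd j : nat)%:Z - (odd i : nat)%:Z) * ((k./2)%:Z - (i./2)%:Z)).
have nE (n : nat) : (n%:R : R) = (odd n)%:R + 2 * (n./2)%:R.
  by rewrite -[in LHS](odd_double_half n) natrD -muln2 natrM mulrC.
rewrite /cross /zigzag /= (nE i) (nE j) (nE k) !(rmorphB, rmorphM) /=.
by rewrite -!pmulrn; ring.
Qed.

Lemma zigzag_area_ge i j k : area (zigzag i) (zigzag j) (zigzag k) != 0 ->
  2 <= area (zigzag i) (zigzag j) (zigzag k).
Proof.
rewrite area_cross; have [z ->] := zigzag_cross i j k.
have [->|z0 _] := eqVneq z 0; first by rewrite mulr0 normr0 mul0r eqxx.
rewrite normrM ger0_norm // -intr_norm.
have : (1 : R) <= `|z|%:~R by rewrite ler1z -gtz0_ge1 normr_gt0.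
by lra.
Qed.

Lemma zigzag_area k : area (zigzag k) (zigzag k.+1) (zigzag k.+2) = 2.
Proof.
rewrite /area /zigzag /= !negbK -(natr1 k.+1) -(natr1 k).
have -> : (k%:R + 1 - k%:R) * (2 * (odd k)%:R - 2 * (odd k)%:R) -
  (2 * (~~ odd k)%:R - 2 * (odd k)%:R) * (k%:R + 1 + 1 - k%:R) =
  4 * ((odd k)%:R - (~~ odd k)%:R) :> R by ring.
by case: (odd k) => /=; rewrite ?sub0r ?mulrN ?normrN ger0_norm //; lra.
Qed.

(** The dot products are 2, 3 and 2. A zigzag of height 1 would have a right angle at the middle
    vertex. *)
Lemma zigzag_acute k :
  acute_dots (zigzag k) (zigzag k.+1) (zigzag k.+2).
Proof.
rewrite /acute_dots /dot /zigzag /= !negbK -(natr1 k.+1) -(natr1 k).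
by case: (odd k) => /=; split; lra.
Qed.

Definition zigzag_set n : {fset point R} := [fset x in map zigzag (iota 0 n)].

Lemma zigzag_setP n x :
  reflect (exists2 k, (k < n)%N & x = zigzag k) (x \in zigzag_set n).
Proof.
rewrite inE; apply: (iffP mapP) => -[k].
  by rewrite mem_iota => kn ->; exists k.
by move=> kn ->; exists k => //; rewrite mem_iota.
Qed.

Lemma card_zigzag_set n : #|` zigzag_set n| = n.
Proof.
rewrite card_fseq undup_id ?size_map ?size_iota //.
by rewrite map_inj_uniq ?iota_uniq //; exact: zigzag_inj.
Qed.

Lemma zigzag_min_acute n k : (k.+2 < n)%N ->
  [fset zigzag k; zigzag k.+1; zigzag k.+2]
    \in min_acute_triangles (zigzag_set n).
Proof.
move=> kn.
have [k0 k1 k2] : [/\ zigzag k \in zigzag_set n, zigzag k.+1 \in zigzag_set n &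
    zigzag k.+2 \in zigzag_set n].
  by split; apply/zigzag_setP; [exists k|exists k.+1|exists k.+2] => //; lia.
apply/min_acute_trianglesP; split.
  by rewrite !fsubUset !fsub1set k0 k1 k2.
have a0 : area (zigzag k) (zigzag k.+1) (zigzag k.+2) != 0 by rewrite zigzag_area.
exists (zigzag k), (zigzag k.+1), (zigzag k.+2); split=> //.
- by rewrite /spanned k0 k1 k2 area_uniq.
- exact: zigzag_acute.
split=> // p q r /and4P[/zigzag_setP[i _ ->] /zigzag_setP[j _ ->]].
move=> /zigzag_setP[l _ ->] _ a; rewrite zigzag_area.
exact: zigzag_area_ge.
Qed.

Lemma zigzag_min_acute_triangles n :
  (n - 2 <= #|` min_acute_triangles (zigzag_set n)|)%N.
Proof.
pose F k := [fset zigzag k; zigzag k.+1; zigzag k.+2].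
have F_inj : injective F.
  move=> i j /fsetP E.
  have := E (zigzag i); have := E (zigzag j).
  (* Each of [i] and [j] lies in the window of three starting at the other, so neither exceeds the
     other. *)
  by rewrite !inE !(inj_eq zigzag_inj) !eqxx /=; lia.
rewrite -[X in (X <= _)%N](size_iota 0) -(size_map F).
apply: uniq_leq_size; first by rewrite map_inj_uniq ?iota_uniq.
move=> T /mapP[k]; rewrite mem_iota => kn ->.
by apply: zigzag_min_acute; lia.
Qed.

End Plane.

Theorem theorem4 (R : realType) :
  (exists C : R, 0 < C /\
     forall (n : nat) (S : {fset point R}), (3 <= n)%N -> #|` S| = n ->
       (#|` min_acute_triangles S|)%:R <= C * n%:R) /\
  (exists c : R, 0 < c /\
     forall n : nat, (3 <= n)%N ->
       exists S : {fset point R},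
         #|` S| = n /\ c * n%:R <= (#|` min_acute_triangles S|)%:R).
Proof.
split.
  exists 8; split=> // n S _ <-.
  by rewrite mulrC -natrM ler_nat min_acute_triangles_le.
(* For [n >= 3] one has [n <= 3 * (n - 2)], with equality at [n = 3]. *)
exists (1 / 3); split; first by lra.
move=> n n3; exists (zigzag_set R n); split; first exact: card_zigzag_set.
apply: (@le_trans _ _ (n - 2)%:R).
  have : (n%:R : R) <= (3 * (n - 2))%:R by rewrite ler_nat; lia.
  by rewrite natrM; lra.
by rewrite ler_nat zigzag_min_acute_triangles.
Qed.
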